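(* The map $\Omega:\mathfrak M^\tau\to\mathcal R$ is $G$-equivariant.
   Context: Setup. $\Gamma=\mathbb Z_m$ is a finite cyclic group embedded in $SL_2(\mathbb C)$ so that the natural two-dimensional representation is $L\cong\epsilon\oplus\epsilon^{-1}$, with $\epsilon$ a primitive character (a generator of the character group $\hat\Gamma$). $R=\mathbb C\langle x,y\rangle*\Gamma$ is the crossed product with $gx=\epsilon(g)xg$, $gy=\epsilon^{-1}(g)yg$ for $g\in\Gamma$. For $\tau\in\mathbb C\Gamma$, $B^\tau=R/R(xy-yx-\tau)R$. Modules are right modules. $W_n$ ($0\le n\le m-1$) is the one-dimensional $\Gamma$-module with character $\epsilon^n$, $e_n\in\mathbb C\Gamma$ is the corresponding idempotent (so $e_ng=\epsilon^n(g)e_n$), and $W_n$ is identified with $\mathbb Ce_n\subset\mathbb C\Gamma$. Throughout, $\tau$ is generic: if $\tau_i$ is the scalar by which $\tau$ acts on $W_i$, then $\sum_i\alpha_i\tau_i\ne0$ for every root $\alpha=(\alpha_0,\dots,\alpha_{m-1})$ (real or imaginary) of the affine root system of type $A_{m-1}$ attached to $\Gamma$ by the McKay correspondence. $\mathcal R$ is the set of isomorphism classes of finitely generated projective $B^\tau$-modules whose class in $K_0(B^\tau)\cong K_0(\Gamma)$ has dimension $1$; here $K_0(\Gamma)$ is the representation ring, and the isomorphism is $[P]\mapsto[P\otimes_{\mathbb C\Gamma}B^\tau]$. Nakajima varieties. For a finite-dimensional $\Gamma$-module $U$, points of $\mathfrak M^\tau_\Gamma(U,W_n)$ are orbits, under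 the group of $\Gamma$-automorphisms $h$ of $U$ acting by $(h\bar Xh^{-1},h\bar Yh^{-1},h\bar i,\bar jh^{-1})$, of quadruples $\bar X,\bar Y\in\mathrm{End}_{\mathbb C}(U)$, $\bar i\in\mathrm{Hom}_\Gamma(W_n,U)$, $\bar j\in\mathrm{Hom}_\Gamma(U,W_n)$ with $\bar X\bar Y-\bar Y\bar X+\bar T=\bar i\,\bar j$, $\bar X\bar G=\epsilon(g)\bar G\bar X$, $\bar Y\bar G=\epsilon^{-1}(g)\bar G\bar Y$ for all $g\in\Gamma$ ($\bar T,\bar G$ being the actions of $\tau,g$ on $U$), and such that no proper $\Gamma$-submodule of $U$ contains $\bar i(W_n)$ and is stable under $\bar X,\bar Y$. $\mathfrak M^\tau=\bigsqcup_{U,n}\mathfrak M^\tau_\Gamma(U,W_n)$ over isomorphism classes of finite-dimensional $\Gamma$-modules $U$ and $0\le n\le m-1$. The map $\Omega$. Let $\mathbf B=I\oplus R$ be the DG algebra with $R$ in degree $0$, $I=R\nu R$ (the ideal $R(xy-yx-\tau)R$ with generator $\nu$ corresponding to $xy-yx-\tau$) in degree $-1$, and differential the inclusion. Given a quadruple $(\bar X,\bar Y,\bar i,\bar j)$ representing a point of $\mathfrak M^\tau_\Gamma(U,W_n)$, put $L^1=U$, a right $R$-module by $u.x=\bar Xu$, $u.y=\bar Yu$, $u.g=\bar Gu$; put $\bar i_n=\bar i(e_n)$ and define $\lambda:R\to\mathbb C$ by $\bar j(\bar i_n.a)=\lambda(a)e_n$. Let $L^0$ be the quotient of $W_n\otimes_{\mathbb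 C\Gamma}R$ by the right $R$-submodule generated by all $e_n\otimes(a(xy-yx-\tau)+\lambda(a))$, $a\in R$; let $d_{\mathbf L}:L^0\to L^1$, $w\otimes a\mapsto\bar i(w).a$; let $\nu$ act by $L^0.\nu=0$, $(\bar i_n.a).\nu=\lambda(a)(e_n\otimes1)$. This gives a DG-module $\mathbf L=L^0\oplus L^1$ over $\mathbf B$, and $\Omega$ sends the point represented by $(\bar X,\bar Y,\bar i,\bar j)$ to the class of the $B^\tau$-module $H^0(\mathbf L)=\ker d_{\mathbf L}$ in $\mathcal R$. The group $G$ and its actions. $G$ is the group of $\Gamma$-equivariant automorphisms of the algebra $R$ (those which are the identity on $\mathbb C\Gamma$) preserving the element $xy-yx\in R$. Each $\sigma\in G$ induces an automorphism of $B^\tau$, again denoted $\sigma$, and $G$ acts on $\mathcal R$ by $\sigma_*(M)=M_{\sigma^{-1}}$, the module $M$ with the new action $m*b=m.\sigma^{-1}(b)$. $G$ acts on $\mathfrak M^\tau$ by $\sigma.(\bar X,\bar Y,\bar i,\bar j)=(\sigma^{-1}(\bar X),\sigma^{-1}(\bar Y),\bar i,\bar j)$, where $\sigma^{-1}(\bar X)$ and $\sigma^{-1}(\bar Y)$ denote the endomorphisms of the right $R$-module $U$ (with $u.x=\bar Xu$, $u.y=\bar Yu$, $u.g=\bar Gu$) by which $\sigma^{-1}(x)$ and $\sigma^{-1}(y)$ act. *)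

(* Defs.v *)
From HB Require Import structures.
From mathcomp Require Import all_boot all_order all_fingroup all_algebra.
From mathcomp Require Import all_solvable all_character.
From mathcomp Require Import finmap boolp reals monalg complex.
From mathcomp Require Import generic_quotient ring_quotient.

Set Implicit Arguments.
Unset Strict Implicit.
Unset Printing Implicit Defensive.

Import GRing.Theory.
Local Open Scope ring_scope.

(* F is specialised to the field of complex numbers in the theorem; it plays the
   role of C in the comments below. *)

Section Characters.
Variables (F : fieldType) (gT : finGroupType).

Definition is_lin_char (chi : gT -> F) :=
  chi 1%g = 1 /\ forall g h, chi (g * h)%g = chi g * chi h.

(* A finite cyclic group with a generator eps of its character group; the
   embedding in SL_2 is g |-> diag(eps g, (eps g)^-1). *)
Record primChar := PrimChar {
  primChar_fun :> gT -> F;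
  primChar_cyclic : cyclic [set: gT];
  primCharP : is_lin_char primChar_fun;
  primChar_gen : forall chi, is_lin_char chi ->
    exists n, forall g, chi g = primChar_fun g ^+ n }.

End Characters.

Section CharTheory.
Variables (F : fieldType) (gT : finGroupType) (eps : primChar F gT).

Lemma pchar1 : eps 1%g = 1. Proof. exact: (primCharP eps).1. Qed.
Lemma pcharM g h : eps (g * h)%g = eps g * eps h.
Proof. exact: (primCharP eps).2. Qed.

Lemma pchar_neq0 g : eps g != 0.
Proof.
apply/eqP => e0; have := pcharM g g^-1%g; rewrite mulgV pchar1 e0 mul0r.
by move/eqP; rewrite oner_eq0.
Qed.

End CharTheory.

(* C<x,y>, with [true] for the letter x and [false] for y. *)
Notation freeXY F := {malg F[{fmonom bool}]}.

Definition letter_wt F gT (eps : primChar F gT) (g : gT) (l : bool) : F :=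
  if l then eps g else (eps g)^-1.

Definition word_wt F gT (eps : primChar F gT) (g : gT) (w : {fmonom bool}) : F :=
  \prod_(l <- (w : seq bool)) letter_wt eps g l.

HB.lock Definition cr_act F gT (eps : primChar F gT) (g : gT) (a : freeXY F) :
    freeXY F :=
  [malg w in msupp a => word_wt eps g w * a@_w].

Section GroupAction.
Variables (F : fieldType) (gT : finGroupType) (eps : primChar F gT).
Implicit Types (a b : freeXY F) (w : {fmonom bool}) (g h : gT).
Local Notation letter_wt := (letter_wt eps).
Local Notation word_wt := (word_wt eps).
Local Notation cr_act := (cr_act eps).

Lemma cr_actE g a w : (cr_act g a)@_w = word_wt g w * a@_w.
Proof. by rewrite unlock mcoeffE; case: msuppP => //; rewrite mulr0. Qed.

Lemma letter_wt1 l : letter_wt 1%g l = 1.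
Proof. by rewrite /letter_wt pchar1 invr1 if_same. Qed.

Lemma letter_wtM g h l : letter_wt (g * h)%g l = letter_wt g l * letter_wt h l.
Proof. by rewrite /letter_wt pcharM invfM; case: l. Qed.

Lemma word_wt1 w : word_wt 1%g w = 1.
Proof. by rewrite /word_wt big1 // => l _; rewrite letter_wt1. Qed.

Lemma word_wtM g h w : word_wt (g * h)%g w = word_wt g w * word_wt h w.
Proof.
by rewrite /word_wt -big_split; apply: eq_bigr => l _; rewrite letter_wtM.
Qed.

Lemma word_wt_mul g w w' :
  word_wt g (mmul w w') = word_wt g w * word_wt g w'.
Proof. by rewrite /word_wt fmM big_cat. Qed.

Lemma word_wt_one g : word_wt g mone = 1.
Proof. by rewrite /word_wt fm1 big_nil. Qed.

Fact cr_act_zmod_morphism g : zmod_morphism (cr_act g).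
Proof.
by move=> a b; apply/malgP => w; rewrite !(cr_actE, mcoeffB) mulrBr.
Qed.
HB.instance Definition _ g :=
  GRing.isZmodMorphism.Build (freeXY F) (freeXY F) (cr_act g)
    (cr_act_zmod_morphism g).

Lemma msupp_cr_act g a : (msupp (cr_act g a) `<=` msupp a)%fset.
Proof.
apply/fsubsetP => w; rewrite -!mcoeff_neq0 cr_actE; apply: contraNneq => ->.
by rewrite mulr0.
Qed.

Lemma cr_actM g a b : cr_act g (a * b) = cr_act g a * cr_act g b.
Proof.
apply/malgP => w; rewrite [LHS]cr_actE [in LHS]mcoeffMl.
rewrite [RHS](mcoeffMlw _ (msupp_cr_act g a) (msupp_cr_act g b)).
rewrite mulr_sumr; apply: eq_bigr => w1 _; rewrite mulr_sumr.
apply: eq_bigr => w2 _; rewrite !cr_actE; case: eqP => [<-|_].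
  by rewrite !mulr1n word_wt_mul mulrACA.
by rewrite !mulr0n mulr0.
Qed.

Lemma cr_act1 g : cr_act g 1 = 1.
Proof.
apply/malgP => w; rewrite cr_actE mcoeff1; case: eqP => [->|_]; last by rewrite mulr0.
by rewrite word_wt_one mul1r.
Qed.

Lemma cr_actZ g c a : cr_act g (c *: a) = c *: cr_act g a.
Proof. by apply/malgP => w; rewrite [LHS]cr_actE [in LHS]mcoeffZ [RHS]mcoeffZ cr_actE mulrCA. Qed.

Lemma cr_act_id a : cr_act 1%g a = a.
Proof. by apply/malgP => w; rewrite cr_actE word_wt1 mul1r. Qed.

Lemma cr_act_comp g h a : cr_act g (cr_act h a) = cr_act (g * h)%g a.
Proof. by apply/malgP => w; rewrite !cr_actE word_wtM mulrA. Qed.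

End GroupAction.

(* The crossed product C<x,y> * Gamma: [r : crossed eps] stands for the formal
   sum \sum_g (r g) g with r g in C<x,y>. *)
Record crossed (F : fieldType) (gT : finGroupType) (eps : primChar F gT) :=
  Crossed { cr_ffun : {ffun gT -> freeXY F} }.

Definition cr_coef F gT (eps : primChar F gT) (r : crossed eps) (g : gT) :=
  cr_ffun r g.
Coercion cr_coef : crossed >-> Funclass.

Section CrossedOps.
Variables (F : fieldType) (gT : finGroupType) (eps : primChar F gT).

Definition cr_mk (f : gT -> freeXY F) : crossed eps :=
  Crossed eps [ffun g => f g].

Lemma cr_mkE f k : cr_mk f k = f k.
Proof. exact: ffunE. Qed.

End CrossedOps.

HB.lock Definition cr_zero F gT (eps : primChar F gT) : crossed eps :=
  cr_mk eps (fun=> 0).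
HB.lock Definition cr_one F gT (eps : primChar F gT) : crossed eps :=
  cr_mk eps (fun g => (g == 1%g)%:R).
HB.lock Definition cr_opp F gT (eps : primChar F gT) (r : crossed eps) :=
  cr_mk eps (fun g => - r g).
HB.lock Definition cr_add F gT (eps : primChar F gT) (r s : crossed eps) :=
  cr_mk eps (fun g => r g + s g).
HB.lock Definition cr_scale F gT (eps : primChar F gT) (c : F)
    (r : crossed eps) :=
  cr_mk eps (fun g => c *: r g).
(* (a g)(b h) = a (g b) gh, where g acts on C<x,y> by g x = eps(g) x and
   g y = eps(g)^-1 y. *)
HB.lock Definition cr_mul F gT (eps : primChar F gT) (r s : crossed eps) :=
  cr_mk eps (fun k => \sum_g r g * cr_act eps g (s (g^-1 * k)%g)).

Section CrossedProduct.
Variables (F : fieldType) (gT : finGroupType) (eps : primChar F gT).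
Local Notation R := (crossed eps).
Implicit Types (r s t : R) (g h k : gT).

HB.instance Definition _ := [isNew for @cr_ffun F gT eps].
HB.instance Definition _ := [Choice of R by <:].

Lemma crP r s : (forall k, r k = s k) -> r = s.
Proof. by case: r s => [r] [s] rs; congr Crossed; apply/ffunP. Qed.

Local Notation cr_zero := (cr_zero eps).
Local Notation cr_one := (cr_one eps).
Local Notation cr_mul := (@cr_mul F gT eps).
Local Notation cr_add := (@cr_add F gT eps).
Local Notation cr_opp := (@cr_opp F gT eps).
Local Notation cr_scale := (@cr_scale F gT eps).
Let zeroE k : cr_zero k = 0. Proof. by rewrite unlock cr_mkE. Qed.
Let oppE r k : cr_opp r k = - r k. Proof. by rewrite unlock cr_mkE. Qed.
Let addE r s k : cr_add r s k = r k + s k. Proof. by rewrite unlock cr_mkE. Qed.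
Let scaleE c r k : cr_scale c r k = c *: r k. Proof. by rewrite unlock cr_mkE. Qed.
Let oneE k : cr_one k = (k == 1%g)%:R. Proof. by rewrite unlock cr_mkE. Qed.
Let mulE r s k : cr_mul r s k = \sum_g r g * cr_act eps g (s (g^-1 * k)%g).
Proof. by rewrite unlock cr_mkE. Qed.

Fact cr_addA : associative cr_add.
Proof. by move=> r s t; apply: crP => k; rewrite !(addE, zeroE, oppE) addrA. Qed.
Fact cr_addC : commutative cr_add.
Proof. by move=> r s; apply: crP => k; rewrite !(addE, zeroE, oppE) addrC. Qed.
Fact cr_add0r : left_id cr_zero cr_add.
Proof. by move=> r; apply: crP => k; rewrite !(addE, zeroE, oppE) add0r. Qed.
Fact cr_addNr : left_inverse cr_zero cr_opp cr_add.
Proof. by move=> r; apply: crP => k; rewrite !(addE, zeroE, oppE) addNr. Qed.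

HB.instance Definition _ := GRing.isZmodule.Build R
  cr_addA cr_addC cr_add0r cr_addNr.

Lemma cr0E k : (0 : R) k = 0. Proof. exact: zeroE. Qed.
Lemma crNE r k : (- r) k = - r k. Proof. exact: oppE. Qed.
Lemma crDE r s k : (r + s) k = r k + s k. Proof. exact: addE. Qed.

Fact cr_scaleA a b r : cr_scale a (cr_scale b r) = cr_scale (a * b) r.
Proof. by apply: crP => k; rewrite !scaleE scalerA. Qed.
Fact cr_scale1 : left_id 1 cr_scale.
Proof. by move=> r; apply: crP => k; rewrite !scaleE scale1r. Qed.
Fact cr_scaleDr : right_distributive cr_scale +%R.
Proof.
by move=> c r s; apply: crP => k; rewrite !(scaleE, crDE) scalerDr.
Qed.
Fact cr_scaleDl r : {morph cr_scale^~ r : a b / a + b}.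
Proof. by move=> a b; apply: crP => k; rewrite !(scaleE, crDE) scalerDl. Qed.

HB.instance Definition _ := GRing.Zmodule_isLmodule.Build F R
  cr_scaleA cr_scale1 cr_scaleDr cr_scaleDl.

Lemma crZE c r k : (c *: r) k = c *: r k. Proof. exact: scaleE. Qed.

Fact cr_mulA : associative cr_mul.
Proof.
move=> r s t; apply: crP => k; rewrite !mulE.
under [RHS]eq_bigr => g _ do rewrite mulE mulr_suml.
rewrite exchange_big /=; apply: eq_bigr => h _.
rewrite mulE raddf_sum mulr_sumr [RHS](reindex_inj (mulgI h)) /=.
apply: eq_bigr => l _.
by rewrite cr_actM cr_act_comp mulKg invMg mulrA mulgA.
Qed.

Fact cr_mul1r : left_id cr_one cr_mul.
Proof.
move=> r; apply: crP => k; rewrite mulE (bigD1 1%g) //= big1 ?addr0.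
  by rewrite oneE eqxx mul1r cr_act_id invg1 mul1g.
by move=> g /negbTE g1; rewrite oneE g1 mul0r.
Qed.

Fact cr_mulr1 : right_id cr_one cr_mul.
Proof.
move=> r; apply: crP => k; rewrite mulE (bigD1 k) //= big1 ?addr0.
  by rewrite oneE mulVg eqxx cr_act1 mulr1.
move=> g gk; rewrite oneE -eq_mulVg1 (negbTE gk).
by rewrite raddf0 mulr0.
Qed.

Fact cr_mulDl : left_distributive cr_mul +%R.
Proof.
move=> r s t; apply: crP => k; rewrite crDE !mulE -big_split.
by apply: eq_bigr => g _; rewrite crDE mulrDl.
Qed.

Fact cr_mulDr : right_distributive cr_mul +%R.
Proof.
move=> r s t; apply: crP => k; rewrite crDE !mulE -big_split.
by apply: eq_bigr => g _; rewrite crDE raddfD mulrDr.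
Qed.

Fact cr_one_neq0 : cr_one != 0.
Proof.
apply/eqP => /(congr1 (fun r : R => r 1%g))/eqP.
by rewrite cr0E oneE eqxx oner_eq0.
Qed.

HB.instance Definition _ := GRing.Zmodule_isNzRing.Build R
  cr_mulA cr_mul1r cr_mulr1 cr_mulDl cr_mulDr cr_one_neq0.

Lemma crME r s k : (r * s) k = \sum_g r g * cr_act eps g (s (g^-1 * k)%g).
Proof. exact: mulE. Qed.
Lemma cr1E k : (1 : R) k = (k == 1%g)%:R. Proof. exact: oneE. Qed.

Fact cr_scaleAl c r s : c *: (r * s) = (c *: r) * s.
Proof.
apply: crP => k; rewrite crZE !crME scaler_sumr.
by apply: eq_bigr => g _; rewrite crZE scalerAl.
Qed.
HB.instance Definition _ := GRing.Lmodule_isLalgebra.Build F R cr_scaleAl.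

End CrossedProduct.

HB.lock Definition cr_in F gT (eps : primChar F gT) (a : freeXY F) :
    crossed eps :=
  cr_mk eps (fun g => if g == 1%g then a else 0).
HB.lock Definition cr_grp F gT (eps : primChar F gT) (h : gT) : crossed eps :=
  cr_mk eps (fun g => (g == h)%:R).
HB.lock Definition cr_x F gT (eps : primChar F gT) : crossed eps :=
  cr_in eps << fmu true >>.
HB.lock Definition cr_y F gT (eps : primChar F gT) : crossed eps :=
  cr_in eps << fmu false >>.

Definition cr_comm F gT (eps : primChar F gT) : crossed eps :=
  cr_x eps * cr_y eps - cr_y eps * cr_x eps.

(* The image of tau in R under the inclusion of C Gamma. *)
Definition cr_grpalg F gT (eps : primChar F gT) (tau : {ffun gT -> F}) :
    crossed eps :=
  \sum_g tau g *: cr_grp eps g.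

Section QuotientModule.
Local Open Scope quotient_scope.
Variables (A : pzRingType) (M : lmodType A) (S : M -> Prop).

(* Membership in the submodule generated by S. *)
Definition submod_gen (m : M) : Prop :=
  forall N : M -> Prop,
    N 0 -> (forall a u v, N u -> N v -> N (a *: u + v)) ->
    (forall u, S u -> N u) -> N m.

Definition submod_genb : {pred M} := fun m => `[< submod_gen m >].

Lemma submod_gen_linear : submod_closed submod_genb.
Proof.
split=> [|a u v /asboolP Su /asboolP Sv]; apply/asboolP => N N0 NL NS //.
by apply: (NL); [apply: Su | apply: Sv].
Qed.

HB.instance Definition _ := GRing.isSubmodClosed.Build A M submod_genb
  submod_gen_linear.

Definition qmod : Type := Quotient.quot submod_genb.
HB.instance Definition _ := GRing.Zmodule.on qmod.

Definition qmod_pi (m : M) : qmod := \pi_(Quotient.quot submod_genb) m.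
Definition qmod_repr (m : qmod) : M := repr (m : Quotient.quot submod_genb).

Lemma qmod_reprK : cancel qmod_repr qmod_pi.
Proof. exact: reprK. Qed.

Lemma qmod_piP u v : qmod_pi u = qmod_pi v <-> submod_gen (u - v).
Proof.
rewrite /qmod_pi; split.
  by move=> /eqP; rewrite -Quotient.idealrBE => /asboolP.
by move=> uv; apply/eqP; rewrite -Quotient.idealrBE; apply/asboolP.
Qed.

Fact qmod_pi_zmod : zmod_morphism qmod_pi.
Proof. by move=> u v; rewrite /qmod_pi raddfB. Qed.
HB.instance Definition _ := GRing.isZmodMorphism.Build M qmod qmod_pi
  qmod_pi_zmod.

Definition qmod_scale (a : A) (m : qmod) : qmod := qmod_pi (a *: qmod_repr m).

Lemma qmod_scale_pi a u : qmod_scale a (qmod_pi u) = qmod_pi (a *: u).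
Proof.
apply/qmod_piP; rewrite -scalerBr.
have /qmod_piP : qmod_pi (qmod_repr (qmod_pi u)) = qmod_pi u by rewrite qmod_reprK.
move=> gen N N0 NL NS; rewrite -[_ *: _]addr0; apply: (NL) => //.
exact: gen.
Qed.

Fact qmod_scaleA a b m : qmod_scale a (qmod_scale b m) = qmod_scale (a * b) m.
Proof. by rewrite -[m]qmod_reprK !qmod_scale_pi scalerA. Qed.
Fact qmod_scale1 : left_id 1 qmod_scale.
Proof. by move=> m; rewrite -[m]qmod_reprK qmod_scale_pi scale1r. Qed.
Fact qmod_scaleDr : right_distributive qmod_scale +%R.
Proof.
move=> a m n; rewrite -[m]qmod_reprK -[n]qmod_reprK -raddfD !qmod_scale_pi.
by rewrite scalerDr raddfD.
Qed.
Fact qmod_scaleDl m : {morph qmod_scale^~ m : a b / a + b}.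
Proof.
by move=> a b; rewrite -[m]qmod_reprK !qmod_scale_pi scalerDl raddfD.
Qed.

HB.instance Definition _ := GRing.Zmodule_isLmodule.Build A qmod
  qmod_scaleA qmod_scale1 qmod_scaleDr qmod_scaleDl.

Fact qmod_pi_scalable : scalable qmod_pi.
Proof. by move=> a u; rewrite -qmod_scale_pi. Qed.
HB.instance Definition _ := GRing.isScalable.Build A M qmod *:%R qmod_pi
  qmod_pi_scalable.

Section Lift.
Variables (N : lmodType A) (f : {linear M -> N}).
Hypothesis fS : forall u, S u -> f u = 0.

Definition qmod_lift (m : qmod) : N := f (qmod_repr m).

Lemma qmod_lift_pi u : qmod_lift (qmod_pi u) = f u.
Proof.
have /qmod_piP gen : qmod_pi (qmod_repr (qmod_pi u)) = qmod_pi u.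
  by rewrite qmod_reprK.
apply/eqP; rewrite -subr_eq0 /qmod_lift -raddfB; apply/eqP.
apply: (gen (fun v => f v = 0)) => //; first exact: raddf0.
by move=> a v w fv fw; rewrite linearP fv fw scaler0 addr0.
Qed.

Lemma qmod_lift_is_linear : linear qmod_lift.
Proof.
move=> a m n; rewrite -[m]qmod_reprK -[n]qmod_reprK -linearP !qmod_lift_pi.
by rewrite linearP.
Qed.
End Lift.

End QuotientModule.

Section QuotientRing.
Local Open Scope quotient_scope.
Variables (A : pzRingType) (S : A -> Prop).

(* Membership in the two-sided ideal generated by S. *)
Definition ideal_gen (a : A) : Prop :=
  forall N : A -> Prop,
    N 0 -> (forall u v, N u -> N v -> N (u + v)) ->
    (forall b c u, N u -> N (b * u * c)) ->
    (forall u, S u -> N u) -> N a.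

Definition ideal_genb : {pred A} := fun a => `[< ideal_gen a >].

Lemma ideal_genM b c a : ideal_gen a -> ideal_gen (b * a * c).
Proof. by move=> Ia N N0 ND NM NS; apply: (NM); apply: Ia. Qed.

Lemma ideal_genD a b : ideal_gen a -> ideal_gen b -> ideal_gen (a + b).
Proof. by move=> Ia Ib N N0 ND NM NS; apply: (ND); [apply: Ia | apply: Ib]. Qed.

Lemma ideal_gen_zmod : zmod_closed ideal_genb.
Proof.
split=> [|a b /asboolP Ia /asboolP Ib]; apply/asboolP; first by move=> N.
apply: ideal_genD => //.
by rewrite -mulN1r -[_ * b]mulr1; apply: ideal_genM.
Qed.

HB.instance Definition _ := GRing.isZmodClosed.Build A ideal_genb
  ideal_gen_zmod.

Definition qring : Type := Quotient.quot ideal_genb.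
HB.instance Definition _ := GRing.Zmodule.on qring.

Definition qring_pi (a : A) : qring := \pi_(Quotient.quot ideal_genb) a.
Definition qring_repr (b : qring) : A := repr (b : Quotient.quot ideal_genb).

Lemma qring_reprK : cancel qring_repr qring_pi.
Proof. exact: reprK. Qed.

Lemma qring_piP a b : qring_pi a = qring_pi b <-> ideal_gen (a - b).
Proof.
rewrite /qring_pi; split.
  by move=> /eqP; rewrite -Quotient.idealrBE => /asboolP.
by move=> ab; apply/eqP; rewrite -Quotient.idealrBE; apply/asboolP.
Qed.

Fact qring_pi_zmod : zmod_morphism qring_pi.
Proof. by move=> a b; rewrite /qring_pi raddfB. Qed.
HB.instance Definition _ := GRing.isZmodMorphism.Build A qring qring_pi
  qring_pi_zmod.

Definition qring_one : qring := qring_pi 1.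
Definition qring_mul (a b : qring) : qring :=
  qring_pi (qring_repr a * qring_repr b).

Lemma qring_mul_pi a b : qring_mul (qring_pi a) (qring_pi b) = qring_pi (a * b).
Proof.
have rep c : ideal_gen (qring_repr (qring_pi c) - c).
  by apply/qring_piP; rewrite qring_reprK.
apply/qring_piP; set a' := qring_repr _; set b' := qring_repr _.
have -> : a' * b' - a * b = 1 * (a' - a) * b' + a * (b' - b) * 1.
  by rewrite mul1r mulr1 mulrBl mulrBr addrA subrK.
by apply: ideal_genD; apply: ideal_genM; apply: rep.
Qed.

Fact qring_mulA : associative qring_mul.
Proof.
move=> a b c; rewrite -[a]qring_reprK -[b]qring_reprK -[c]qring_reprK.
by rewrite !qring_mul_pi mulrA.
Qed.
Fact qring_mul1r : left_id qring_one qring_mul.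
Proof. by move=> a; rewrite -[a]qring_reprK qring_mul_pi mul1r. Qed.
Fact qring_mulr1 : right_id qring_one qring_mul.
Proof. by move=> a; rewrite -[a]qring_reprK qring_mul_pi mulr1. Qed.
Fact qring_mulDl : left_distributive qring_mul +%R.
Proof.
move=> a b c; rewrite -[a]qring_reprK -[b]qring_reprK -[c]qring_reprK.
by rewrite -raddfD !qring_mul_pi -raddfD mulrDl.
Qed.
Fact qring_mulDr : right_distributive qring_mul +%R.
Proof.
move=> a b c; rewrite -[a]qring_reprK -[b]qring_reprK -[c]qring_reprK.
by rewrite -raddfD !qring_mul_pi -raddfD mulrDr.
Qed.

HB.instance Definition _ := GRing.Zmodule_isPzRing.Build qring
  qring_mulA qring_mul1r qring_mulr1 qring_mulDl qring_mulDr.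

Fact qring_pi_monoid : monoid_morphism qring_pi.
Proof. by split=> // a b; rewrite /= -qring_mul_pi. Qed.
HB.instance Definition _ := GRing.isMonoidMorphism.Build A qring qring_pi
  qring_pi_monoid.

End QuotientRing.

Section CrossedTheory.
Variables (F : fieldType) (gT : finGroupType) (eps : primChar F gT).
Local Notation R := (crossed eps).
Implicit Types (r s : R) (a b : freeXY F) (g h : gT).

Lemma pchar_abelian g h : (g * h = h * g)%g.
Proof.
have /centsP := cyclic_abelian (primChar_cyclic eps).
by move=> /(_ g (in_setT g) h (in_setT h)).
Qed.

Lemma cr_sumE (I : Type) (l : seq I) (P : pred I) (f : I -> R) k :
  (\sum_(i <- l | P i) f i) k = \sum_(i <- l | P i) f i k.
Proof.
by apply: (big_morph (fun r : R => r k)) => [r s|]; rewrite ?crDE ?cr0E.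
Qed.

Lemma cr_inE a k : cr_in eps a k = if k == 1%g then a else 0.
Proof. by rewrite unlock cr_mkE. Qed.
Lemma cr_grpE g k : cr_grp eps g k = (k == g)%:R.
Proof. by rewrite unlock cr_mkE. Qed.

Lemma cr_in_grpE a g k : (cr_in eps a * cr_grp eps g) k = if k == g then a else 0.
Proof.
rewrite crME (bigD1 1%g) //= big1 ?addr0 => [|h /negbTE h1]; last first.
  by rewrite cr_inE h1 mul0r.
rewrite cr_inE eqxx cr_grpE invg1 mul1g cr_act_id.
by case: eqP; rewrite ?mulr1 ?mulr0.
Qed.

Lemma crE r : r = \sum_g cr_in eps (r g) * cr_grp eps g.
Proof.
apply: crP => k; rewrite cr_sumE (bigD1 k) //= cr_in_grpE eqxx.
by rewrite big1 ?addr0 // => g gk; rewrite cr_in_grpE eq_sym (negbTE gk).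
Qed.

Lemma cr_grp_inE a g k : (cr_grp eps g * cr_in eps a) k =
  if k == g then cr_act eps g a else 0.
Proof.
rewrite crME (bigD1 g) //= big1 ?addr0 => [|h /negbTE h1]; last first.
  by rewrite cr_grpE h1 mul0r.
rewrite cr_grpE eqxx mul1r cr_inE -eq_mulVg1 eq_sym.
by case: eqP => // _; rewrite raddf0.
Qed.

(* The defining relations of the crossed product. *)
Lemma cr_grp_in g a :
  cr_grp eps g * cr_in eps a = cr_in eps (cr_act eps g a) * cr_grp eps g.
Proof. by apply: crP => k; rewrite cr_grp_inE cr_in_grpE. Qed.

Lemma cr_actU g w : cr_act eps g << w >> = word_wt eps g w *: << w >>.
Proof.
apply/malgP => v; rewrite [LHS]cr_actE [RHS]mcoeffZ !mcoeffU1.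
by case: eqP => [->|] //; rewrite !mulr0.
Qed.

Lemma cr_in_is_linear : linear (cr_in eps).
Proof.
move=> c a b; apply: crP => k; rewrite crDE crZE !cr_inE.
by case: eqP => // _; rewrite scaler0 addr0.
Qed.

Lemma cr_inM a b : cr_in eps (a * b) = cr_in eps a * cr_in eps b.
Proof.
apply: crP => k; rewrite crME (bigD1 1%g) //= big1 ?addr0 => [|h /negbTE h1].
  rewrite !cr_inE eqxx invg1 mul1g cr_act_id.
  by case: eqP => //; rewrite mulr0.
by rewrite cr_inE h1 mul0r.
Qed.

Lemma cr_grpM g h : cr_grp eps (g * h)%g = cr_grp eps g * cr_grp eps h.
Proof.
apply: crP => k; rewrite crME (bigD1 g) //= big1 ?addr0 => [|l /negbTE l1].
  rewrite !cr_grpE eqxx mul1r (canF_eq (mulKVg g)).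
  by case: eqP; rewrite ?cr_act1 ?raddf0.
by rewrite cr_grpE l1 mul0r.
Qed.

Lemma cr_grp1 : cr_grp eps 1%g = 1.
Proof. by apply: crP => k; rewrite cr_grpE cr1E. Qed.

Lemma cr_grp_x g :
  cr_grp eps g * cr_x eps = eps g *: (cr_x eps * cr_grp eps g).
Proof.
rewrite [cr_x]unlock; apply: crP => k; rewrite crZE cr_grp_inE cr_in_grpE cr_actU.
rewrite /word_wt fmU big_seq1 /=.
by case: eqP => //; rewrite scaler0.
Qed.

Lemma cr_grp_y g :
  cr_grp eps g * cr_y eps = (eps g)^-1 *: (cr_y eps * cr_grp eps g).
Proof.
rewrite [cr_y]unlock; apply: crP => k; rewrite crZE cr_grp_inE cr_in_grpE cr_actU.
rewrite /word_wt fmU big_seq1 /=.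
by case: eqP => //; rewrite scaler0.
Qed.

Lemma cr_ind (P : R -> Prop) :
  P 0 -> (forall c r s, P r -> P s -> P (c *: r + s)) ->
  (forall r s, P r -> P s -> P (r * s)) ->
  (forall g, P (cr_grp eps g)) -> P (cr_x eps) -> P (cr_y eps) ->
  forall r, P r.
Proof.
move=> P0 PL PM Pg Px Py r.
have PD u v : P u -> P v -> P (u + v).
  by move=> Pu Pv; rewrite -[u]scale1r; apply: PL.
have PZ c u : P u -> P (c *: u) by move=> Pu; rewrite -[_ *: u]addr0; apply: PL.
have Pw w : P (cr_in eps << w >>).
  have -> : w = FMonom (w : seq bool) by rewrite fmK.
  elim: (w : seq bool) => [|l u IH].
    have -> : << FMonom [::] >> = 1 :> freeXY F.
      by apply/malgP => v; rewrite mcoeff1 mcoeffU1 -fmoneE eq_sym.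
    have -> : cr_in eps 1 = cr_grp eps 1%g; last exact: Pg.
    by apply: crP => k; rewrite cr_inE cr_grpE; case: eqP.
  have -> : << FMonom (l :: u) >> = << fmu l >> * << FMonom u >> :> freeXY F.
    rewrite malgM_def fgmulUU mulr1; congr mkmalgU.
    by apply/eqP; rewrite fmP fmM fmU.
  rewrite cr_inM; apply: (PM) => //.
  by case: l; [move: Px; rewrite [cr_x]unlock | move: Py; rewrite [cr_y]unlock].
rewrite (crE r); elim/big_ind: _ => // g _; apply: (PM) => //.
have in0 : cr_in eps 0 = 0 by apply: crP => k; rewrite cr_inE cr0E if_same.
rewrite (monalgE (r g)); elim/big_rec: _ => [|w a _ Pa]; first by rewrite in0.
have -> : << (r g)@_w *g w >> = (r g)@_w *: << w >> :> freeXY F.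
  by apply/malgP => v; rewrite mcoeffZ !mcoeffU mulrnAr mulr1.
by rewrite cr_in_is_linear; apply: PL.
Qed.

End CrossedTheory.

Notation gammaRep F gT d := (mx_representation F [set: gT]%G d).

(* The matrix [cr_mx U X Y r] of u |-> u.r for the right R-module structure on
   U given by u.x = X u, u.y = Y u, u.g = U(g) u; it is antimultiplicative
   in r. *)
Section ModuleOfMatricesDef.
Variables (F : fieldType) (d : nat) (X Y : 'M[F]_d).

Definition letter_mx (l : bool) : 'M[F]_d := if l then X else Y.
Definition word_mx (w : {fmonom bool}) : 'M[F]_d :=
  foldl (fun M l => letter_mx l *m M) 1%:M (w : seq bool).
Definition poly_mx (a : freeXY F) : 'M[F]_d :=
  \sum_(w <- msupp a) a@_w *: word_mx w.

End ModuleOfMatricesDef.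

HB.lock Definition cr_mx F gT (eps : primChar F gT) (d : nat)
    (U : gammaRep F gT d) (X Y : 'M[F]_d) (r : crossed eps) : 'M[F]_d :=
  \sum_g U g *m poly_mx X Y (r g).

Section ModuleOfMatrices.
Variables (F : fieldType) (gT : finGroupType) (eps : primChar F gT).
Local Notation R := (crossed eps).
Variables (d : nat) (U : gammaRep F gT d) (X Y : 'M[F]_d).
Implicit Types (r s : R) (a b : freeXY F) (w v : {fmonom bool}) (g h : gT).
Local Notation letter_mx := (letter_mx X Y).
Local Notation word_mx := (word_mx X Y).
Local Notation poly_mx := (poly_mx X Y).
Local Notation cr_mx := (@cr_mx F gT eps d U X Y).

Lemma cr_mxE r : cr_mx r = \sum_g U g *m poly_mx (r g).
Proof. by rewrite unlock. Qed.

Lemma poly_mxEw (D : {fset {fmonom bool}}) a : (msupp a `<=` D)%fset ->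
  poly_mx a = \sum_(w <- D) a@_w *: word_mx w.
Proof.
move=> le; rewrite /poly_mx (big_fset_incl _ le) //= => w _ /mcoeff_outdom ->.
by rewrite scale0r.
Qed.

Lemma poly_mx_is_linear : linear poly_mx.
Proof.
move=> c a b.
set D := (msupp a `|` msupp b)%fset.
have aD : (msupp a `<=` D)%fset by apply: fsubsetUl.
have bD : (msupp b `<=` D)%fset by apply: fsubsetUr.
have cD : (msupp (c *: a + b) `<=` D)%fset.
  apply: (fsubset_trans (msuppD_le _ _)); apply: fsetSU.
  exact: msuppZ_le.
rewrite (poly_mxEw aD) (poly_mxEw bD) (poly_mxEw cD) scaler_sumr -big_split /=.
by apply: eq_bigr => w _; rewrite mcoeffD mcoeffZ scalerDl scalerA.
Qed.
HB.instance Definition _ :=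
  GRing.isLinear.Build F (freeXY F) 'M[F]_d *:%R poly_mx poly_mx_is_linear.

Lemma poly_mxU c w : poly_mx << c *g w >> = c *: word_mx w.
Proof.
have -> : << c *g w >> = c *: << w >> :> freeXY F.
  by apply/malgP => v; rewrite mcoeffZ !mcoeffU mulrnAr mulr1.
rewrite linearZ /=; congr (_ *: _).
by rewrite (poly_mxEw msuppU_le) big_seq_fset1 mcoeffUU scale1r.
Qed.

Lemma word_mxM w v : word_mx (mmul w v) = word_mx v *m word_mx w.
Proof.
rewrite /word_mx fmM foldl_cat; move: (foldl _ 1%:M w) => M.
elim/last_ind: (v : seq bool) => [|u l IH] /=; first by rewrite mul1mx.
by rewrite -cats1 !foldl_cat /= IH mulmxA.
Qed.

Lemma poly_mxM a b : poly_mx (a * b) = poly_mx b *m poly_mx a.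
Proof.
rewrite malgME raddf_sum /= {3}/poly_mx mulmx_sumr; apply: eq_bigr => w _.
rewrite raddf_sum /= {2}/poly_mx mulmx_suml; apply: eq_bigr => v _.
rewrite poly_mxU word_mxM -scalemxAl -scalemxAr scalerA; congr (_ *: _).
exact: mulrC.
Qed.

Lemma cr_mx_is_linear : linear cr_mx.
Proof.
move=> c r s; rewrite !cr_mxE scaler_sumr -big_split /=; apply: eq_bigr => g _.
by rewrite crDE crZE linearP mulmxDr -scalemxAr.
Qed.
HB.instance Definition _ :=
  GRing.isLinear.Build F R 'M[F]_d *:%R cr_mx cr_mx_is_linear.

Lemma cr_mxZ c r : cr_mx (c *: r) = c *: cr_mx r.
Proof. exact: linearZ. Qed.

Lemma cr_mx_in a : cr_mx (cr_in eps a) = poly_mx a.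
Proof.
rewrite cr_mxE (bigD1 1%g) //= big1 ?addr0 => [|g /negbTE g1].
  by rewrite cr_inE eqxx repr_mx1 mul1mx.
by rewrite cr_inE g1 linear0 mulmx0.
Qed.

Lemma cr_mx_grp g : cr_mx (cr_grp eps g) = U g.
Proof.
rewrite cr_mxE (bigD1 g) //= big1 ?addr0 => [|h /negbTE hg].
  rewrite cr_grpE eqxx mulr1n -[1]mpolyC1E poly_mxU scale1r.
  by rewrite /word_mx fm1 mulmx1.
by rewrite cr_grpE hg linear0 mulmx0.
Qed.

Lemma cr_mx_x : cr_mx (cr_x eps) = X.
Proof. by rewrite [cr_x]unlock cr_mx_in poly_mxU scale1r /word_mx fmU /= mulmx1. Qed.

Lemma cr_mx_y : cr_mx (cr_y eps) = Y.
Proof. by rewrite [cr_y]unlock cr_mx_in poly_mxU scale1r /word_mx fmU /= mulmx1. Qed.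

Lemma cr_mx_stable (V : {vspace 'cV[F]_d}) (r : R) :
  (forall g, {in V, forall v : 'cV[F]_d, U g *m v \in V}) ->
  {in V, forall v : 'cV[F]_d, X *m v \in V} -> {in V, forall v : 'cV[F]_d, Y *m v \in V} ->
  {in V, forall v : 'cV[F]_d, cr_mx r *m v \in V}.
Proof.
move=> UV XV YV v vV; rewrite cr_mxE mulmx_suml rpred_sum // => g _.
rewrite -mulmxA; apply: (UV); rewrite mulmx_suml rpred_sum // => w _.
rewrite -scalemxAl rpredZ //; rewrite /word_mx.
elim/last_ind: (w : seq bool) => [|u l IH]; first by rewrite mul1mx.
by rewrite -cats1 foldl_cat /= -mulmxA; case: l; [apply: XV | apply: YV].
Qed.

Hypothesis XU : forall g, X *m U g = eps g *: (U g *m X).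
Hypothesis YU : forall g, Y *m U g = (eps g)^-1 *: (U g *m Y).

Lemma word_mx_grp w g : word_mx w *m U g = word_wt eps g w *: (U g *m word_mx w).
Proof.
rewrite /word_mx /word_wt; elim/last_ind: (w : seq bool) => [|u l IH] /=.
  by rewrite big_nil mul1mx mulmx1 scale1r.
rewrite -cats1 foldl_cat /= big_cat big_seq1 /= -mulmxA IH -scalemxAr !mulmxA.
have -> : letter_mx l *m U g = letter_wt eps g l *: (U g *m letter_mx l).
  by case: l.
by rewrite -scalemxAl scalerA.
Qed.

Lemma poly_mx_grp a g : poly_mx a *m U g = U g *m poly_mx (cr_act eps g a).
Proof.
rewrite (poly_mxEw (msupp_cr_act eps g a)) /poly_mx mulmx_suml mulmx_sumr.
apply: eq_bigr => w _; rewrite cr_actE -scalemxAl word_mx_grp scalerA -scalemxAr.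
by rewrite mulrC.
Qed.

Lemma cr_mxM r s : cr_mx (r * s) = cr_mx s *m cr_mx r.
Proof.
rewrite !cr_mxE mulmx_sumr.
have E k : U k *m poly_mx ((r * s) k) = \sum_g
    U k *m poly_mx (r g * cr_act eps g (s (g^-1 * k)%g)).
  by rewrite crME (raddf_sum poly_mx) mulmx_sumr.
under eq_bigr => k _ do rewrite E.
rewrite exchange_big /=; apply: eq_bigr => g _.
rewrite (reindex_inj (mulgI g)) /= mulmx_suml; apply: eq_bigr => h _.
rewrite mulKg poly_mxM (pchar_abelian eps) repr_mxM ?in_setT //.
by rewrite !mulmxA -[_ *m poly_mx _ *m U g]mulmxA poly_mx_grp !mulmxA.
Qed.

Lemma cr_mx1 : cr_mx 1 = 1%:M.
Proof. by rewrite -(cr_grp1 eps) cr_mx_grp repr_mx1. Qed.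

Lemma cr_mx_grpalg (tau : {ffun gT -> F}) :
  cr_mx (cr_grpalg eps tau) = \sum_g tau g *: U g.
Proof.
rewrite /cr_grpalg (raddf_sum cr_mx); apply: eq_bigr => g _.
by rewrite -[U g]cr_mx_grp; exact: cr_mxZ.
Qed.

End ModuleOfMatrices.

(* Right modules over A are left modules over the converse ring A^c. *)

Section TensorProduct.
Variables (F : fieldType) (gT : finGroupType) (eps : primChar F gT).
Variables (A : pzRingType) (f : {rmorphism crossed eps -> A}).
Variables (d : nat) (P : gammaRep F gT d).

(* p (x)_C a, as an element of C^d (x)_C A = A^d. *)
Definition pure_tens (p : 'cV[F]_d) (a : A) : 'cV[A^c]_d :=
  \col_k (f ((p k 0)%:A) * a).

Definition tens_rel (v : 'cV[A^c]_d) : Prop :=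
  exists p g a,
    v = pure_tens (P g *m p) a - pure_tens p (f (cr_grp eps g) * a).

(* The right A-module P (x)_{C Gamma} A, for p.g = P(g) p. *)
Definition tens : lmodType A^c := qmod tens_rel.

End TensorProduct.

Section Setting.
Variables (F : fieldType) (gT : finGroupType) (eps : primChar F gT).
Local Notation R := (crossed eps).

(* W_n, in the basis e_n. *)
Definition Wn_mx (n : nat) (g : gT) : 'M[F]_1 := (eps g ^+ n)%:M.

Fact Wn_repr n : mx_repr [set: gT]%G (Wn_mx n).
Proof.
split=> [|g h _ _]; first by rewrite /Wn_mx pchar1 expr1n.
by rewrite /Wn_mx pcharM exprMn scalar_mxM.
Qed.

Definition Wn (n : nat) : gammaRep F gT 1 := MxRepresentation (Wn_repr n).

Variable tau : {ffun gT -> F}.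

Definition relator : R := cr_comm eps - cr_grpalg eps tau.

Definition Btau : pzRingType := qring (eq relator).

Definition Bpi : {rmorphism R -> Btau} := @qring_pi R (eq relator).

(* The endomorphisms X, Y act on column vectors, i : W_n -> U and j : U -> W_n
   are matrices with respect to the basis e_n of W_n. *)
Record quadruple := Quadruple {
  q_n : 'I_#|gT|;
  q_dim : nat;
  q_U : gammaRep F gT q_dim;
  q_X : 'M[F]_q_dim;
  q_Y : 'M[F]_q_dim;
  q_i : 'M[F]_(q_dim, 1);
  q_j : 'M[F]_(1, q_dim);
  q_moment : q_X *m q_Y - q_Y *m q_X + \sum_g tau g *: q_U g = q_i *m q_j;
  q_XU : forall g, q_X *m q_U g = eps g *: (q_U g *m q_X);
  q_YU : forall g, q_Y *m q_U g = (eps g)^-1 *: (q_U g *m q_Y);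
  q_iU : forall g, q_U g *m q_i = q_i *m Wn q_n g;
  q_jU : forall g, q_j *m q_U g = Wn q_n g *m q_j;
  q_stable : forall V : {vspace 'cV[F]_q_dim},
    q_i \in V ->
    (forall g, {in V, forall v, q_U g *m v \in V}) ->
    {in V, forall v, q_X *m v \in V} ->
    {in V, forall v, q_Y *m v \in V} ->
    V = fullv }.

Section DGModule.
Variable q : quadruple.
Local Notation d := (q_dim q).

Definition act_mx (r : R) : 'M[F]_d := cr_mx (q_U q) (q_X q) (q_Y q) r.

Lemma act_mxM r s : act_mx (r * s) = act_mx s *m act_mx r.
Proof. by apply: cr_mxM; [exact: q_XU | exact: q_YU]. Qed.
Lemma act_mx1 : act_mx 1 = 1%:M.
Proof. exact: cr_mx1. Qed.
Lemma act_mxD r s : act_mx (r + s) = act_mx r + act_mx s.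
Proof. exact: raddfD. Qed.
Lemma act_mxB r s : act_mx (r - s) = act_mx r - act_mx s.
Proof. exact: raddfB. Qed.
Lemma act_mxZ c r : act_mx (c *: r) = c *: act_mx r.
Proof. exact: cr_mxZ. Qed.

Lemma act_mx_grp g : act_mx (cr_grp eps g) = q_U q g.
Proof. exact: cr_mx_grp. Qed.

Lemma act_mx_x : act_mx (cr_x eps) = q_X q.
Proof. exact: cr_mx_x. Qed.
Lemma act_mx_y : act_mx (cr_y eps) = q_Y q.
Proof. exact: cr_mx_y. Qed.

Lemma act_mx_relator : act_mx relator = - (q_i q *m q_j q).
Proof.
rewrite /relator /cr_comm !act_mxB !act_mxM /act_mx cr_mx_x cr_mx_y.
by rewrite cr_mx_grpalg -q_moment opprD opprB.
Qed.

Definition L1 : Type := 'cV[F]_d.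
HB.instance Definition _ := GRing.Zmodule.on L1.

Definition L1_scale (a : R^c) (u : L1) : L1 := act_mx a *m (u : 'cV_d).

Fact L1_scaleA a b u : L1_scale a (L1_scale b u) = L1_scale (a * b) u.
Proof. by rewrite /L1_scale mulmxA -act_mxM. Qed.
Fact L1_scale1 : left_id 1 L1_scale.
Proof. by move=> u; rewrite /L1_scale act_mx1 mul1mx. Qed.
Fact L1_scaleDr : right_distributive L1_scale +%R.
Proof. by move=> a u v; rewrite /L1_scale mulmxDr. Qed.
Fact L1_scaleDl u : {morph L1_scale^~ u : a b / a + b}.
Proof. by move=> a b; rewrite /L1_scale act_mxD mulmxDl. Qed.
HB.instance Definition _ := GRing.Zmodule_isLmodule.Build R^c L1
  L1_scaleA L1_scale1 L1_scaleDr L1_scaleDl.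

Definition lam (a : R) : F := (q_j q *m (act_mx a *m q_i q)) 0 0.

(* W_n (x)_{C Gamma} R and its elements e_n (x) a. *)
Definition WR : lmodType R^c := tens idfun (Wn (q_n q)).
Definition en_tens (a : R) : WR :=
  qmod_pi _ (pure_tens idfun (const_mx 1) a).

Definition L0_rel (m : WR) : Prop :=
  exists a, m = en_tens (a * relator + (lam a)%:A).

Definition L0 : lmodType R^c := qmod L0_rel.

Definition en_tens0 (a : R) : L0 := qmod_pi _ (en_tens a).

(* w (x) a |-> i(w).a *)
Definition dL_fun (v : 'cV[R^c]_1) : L1 := act_mx (v 0 0 : R) *m q_i q.

Fact dL_fun_linear : linear dL_fun.
Proof.
move=> a u v; rewrite /dL_fun !mxE.
rewrite -[a *: _]/(act_mx a *m (act_mx (u 0 0) *m q_i q)).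
by rewrite mulmxA -act_mxM -mulmxDl -act_mxD.
Qed.
HB.instance Definition _ :=
  GRing.isLinear.Build R^c 'cV[R^c]_1 L1 *:%R dL_fun dL_fun_linear.

Lemma dL_fun_pure p a :
  dL_fun (pure_tens idfun p a) = act_mx a *m (q_i q *m p).
Proof.
rewrite /dL_fun mxE /= -scalerAl mul1r act_mxZ -scalemxAl.
by rewrite [in RHS](mx11_scalar p) mul_mx_scalar -scalemxAr.
Qed.

Fact dL_fun_tens v : tens_rel idfun (Wn (q_n q)) v -> dL_fun v = 0.
Proof.
move=> [p [g [a ->]]]; rewrite raddfB /= !dL_fun_pure /= act_mxM.
rewrite act_mx_grp -[X in _ - X]mulmxA [q_U q g *m _]mulmxA q_iU.
by rewrite -!mulmxA subrr.
Qed.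

Definition dWR : WR -> L1 := qmod_lift dL_fun.
HB.instance Definition _ :=
  GRing.isLinear.Build R^c WR L1 *:%R dWR (qmod_lift_is_linear dL_fun_tens).

Lemma dWR_en a : dWR (en_tens a) = act_mx a *m q_i q.
Proof.
rewrite /dWR (qmod_lift_pi dL_fun_tens).
rewrite [LHS]dL_fun_pure.
by rewrite [const_mx 1]mx11_scalar mxE mulmx1.
Qed.

Fact dWR_rel m : L0_rel m -> dWR m = 0.
Proof.
move=> [a ->]; rewrite dWR_en act_mxD act_mxM act_mx_relator mulNmx.
rewrite act_mxZ act_mx1 mulmxDl -scalemxAl mul1mx.
rewrite mulNmx -!mulmxA [q_j q *m _]mx11_scalar mul_mx_scalar.
by rewrite addNr.
Qed.

Definition dL : L0 -> L1 := qmod_lift dWR.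
HB.instance Definition _ :=
  GRing.isLinear.Build R^c L0 L1 *:%R dL (qmod_lift_is_linear dWR_rel).

Lemma dL_en a : dL (en_tens0 a) = act_mx a *m q_i q.
Proof. by rewrite /dL (qmod_lift_pi dWR_rel) [LHS]dWR_en. Qed.

(* The action of nu, L1 -> L0: it sends i_n.a to lam(a) (e_n (x) 1), where
   j(i_n.a) = lam(a) e_n. *)
Definition nu_act (u : L1) : L0 :=
  en_tens0 (((q_j q *m (u : 'cV_d)) 0 0)%:A).

Lemma nu_actE a : nu_act (act_mx a *m q_i q) = en_tens0 ((lam a)%:A).
Proof. by []. Qed.

Lemma en_tens_is_zmod : zmod_morphism en_tens.
Proof.
move=> a b; rewrite /en_tens -raddfB; congr qmod_pi.
by apply/colP => k; rewrite !mxE mulrBr.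
Qed.

Lemma en_tens0_is_zmod : zmod_morphism en_tens0.
Proof. by move=> a b; rewrite /en_tens0 en_tens_is_zmod raddfB. Qed.
HB.instance Definition _ := GRing.isZmodMorphism.Build R L0 en_tens0
  en_tens0_is_zmod.

Lemma en_tensM a b : en_tens (a * b) = (b : R^c) *: en_tens a.
Proof.
rewrite /en_tens -linearZ; congr qmod_pi.
by apply/colP => k; rewrite !mxE /= mulrA.
Qed.

Lemma en_tens0M a b : en_tens0 (a * b) = (b : R^c) *: en_tens0 a.
Proof. by rewrite /en_tens0 en_tensM linearZ. Qed.

Lemma en_tens0_surj m : exists a, m = en_tens0 a.
Proof.
rewrite -[m]qmod_reprK -[qmod_repr m]qmod_reprK.
set v := qmod_repr _; exists (v 0 0 : R); rewrite /en_tens0 /en_tens.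
congr (qmod_pi _ (qmod_pi _ _)).
by apply/colP => k; rewrite !mxE scale1r mul1r (ord1 k).
Qed.

Lemma en_tens0_rel a : en_tens0 (a * relator) = - en_tens0 ((lam a)%:A).
Proof.
apply/eqP; rewrite -subr_eq0 opprK -raddfD -[0](raddf0 (qmod_pi L0_rel)).
apply/eqP/qmod_piP; rewrite subr0 => N _ _; apply.
by exists a.
Qed.

(* x y - y x - tau acts on L0 as - d_L followed by nu. *)
Lemma L0_relator (m : L0) : (relator : R^c) *: m = - nu_act (dL m).
Proof.
have [a ->] := en_tens0_surj m.
by rewrite -en_tens0M en_tens0_rel dL_en nu_actE.
Qed.

Definition kerd : {pred L0} := fun m => dL m == 0.

Fact kerd_zmod : zmod_closed kerd.
Proof.
split=> [|u v /eqP du /eqP dv]; apply/eqP; first exact: raddf0.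
by rewrite raddfB /= du dv subrr.
Qed.
HB.instance Definition _ := GRing.isZmodClosed.Build L0 kerd kerd_zmod.

(* H^0(L) = ker d_L, a B-module since by [L0_relator] the element x y - y x - tau
   acts on it as zero. *)
Record H0 := MkH0 { H0_val : L0; H0_valP : H0_val \in kerd }.
HB.instance Definition _ := [isSub for H0_val].
HB.instance Definition _ := [Choice of H0 by <:].
HB.instance Definition _ := [SubChoice_isSubZmodule of H0 by <:].

Lemma H0_val_dL (m : H0) : dL (H0_val m) = 0.
Proof. exact/eqP/(H0_valP m). Qed.

Lemma dL_scale0 (a : R) (m : L0) : dL m = 0 -> dL ((a : R^c) *: m) = 0.
Proof. by move=> dm; rewrite linearZ /= dm scaler0. Qed.

Lemma ideal_kills (a : R) (m : L0) :
  ideal_gen (eq relator) a -> dL m = 0 -> (a : R^c) *: m = 0.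
Proof.
move=> Ia; move: m; apply: (Ia (fun a : R =>
  forall m : L0, dL m = 0 -> (a : R^c) *: m = 0)) => //.
- by move=> m _; rewrite scale0r.
- move=> u v IHu IHv m dm.
  by rewrite -[u + v]/((u : R^c) + (v : R^c)) scalerDl IHu // IHv // addr0.
- move=> b c u IHu m dm.
  rewrite -[b * u * c]/((c : R^c) * ((u : R^c) * (b : R^c))) -!scalerA.
  by rewrite IHu ?scaler0 //; apply: dL_scale0.
- move=> _ <- m dm; rewrite L0_relator dm /nu_act mulmx0 mxE scale0r.
  by rewrite raddf0 oppr0.
Qed.

Definition H0_scale (b : Btau^c) (m : H0) : H0 :=
  MkH0 (introT eqP (dL_scale0 (qring_repr b) (H0_val_dL m))).

Lemma H0_scale_pi (a : R) (m : H0) :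
  H0_val (H0_scale (Bpi a) m) = (a : R^c) *: H0_val m.
Proof.
apply/eqP; rewrite -subr_eq0 -scalerBl; apply/eqP.
apply: ideal_kills; last exact: H0_val_dL.
by apply/qring_piP; rewrite qring_reprK.
Qed.

Fact H0_scaleA a b m : H0_scale a (H0_scale b m) = H0_scale (a * b) m.
Proof.
rewrite -[a]qring_reprK -[b]qring_reprK.
move: (qring_repr a) (qring_repr b) => {}a {}b.
have -> : (qring_pi _ a : Btau^c) * qring_pi _ b = Bpi (b * a).
  by rewrite rmorphM.
by apply: val_inj; rewrite [LHS]H0_scale_pi H0_scale_pi [RHS]H0_scale_pi scalerA.
Qed.
Fact H0_scale1 : left_id 1 H0_scale.
Proof.
move=> m; have -> : (1 : Btau^c) = Bpi 1 by rewrite rmorph1.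
by apply: val_inj; rewrite [LHS]H0_scale_pi scale1r.
Qed.
Fact H0_scaleDr : right_distributive H0_scale +%R.
Proof. by move=> a u v; apply: val_inj; rewrite /= scalerDr. Qed.
Fact H0_scaleDl m : {morph H0_scale^~ m : a b / a + b}.
Proof.
move=> a b; rewrite -[a]qring_reprK -[b]qring_reprK.
move: (qring_repr a) (qring_repr b) => {}a {}b.
have -> : (qring_pi _ a : Btau^c) + qring_pi _ b = Bpi (a + b).
  by rewrite raddfD.
apply: val_inj; rewrite [LHS]H0_scale_pi raddfD /=.
by rewrite [X in _ = X + _]H0_scale_pi [X in _ = _ + X]H0_scale_pi -scalerDl.
Qed.
HB.instance Definition _ := GRing.Zmodule_isLmodule.Build Btau^c H0
  H0_scaleA H0_scale1 H0_scaleDr H0_scaleDl.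

End DGModule.
End Setting.

Section IsomorphismClasses.
Variable A : pzRingType.

Definition lmod_iso (M N : lmodType A) : Prop :=
  exists f : {linear M -> N}, bijective f.

Definition iso_class (M : lmodType A) : lmodType A -> Prop :=
  fun N => lmod_iso M N.

Definition fg_projective (M : lmodType A) : Prop :=
  exists (k : nat) (N : lmodType A), lmod_iso (M * N)%type 'cV[A]_k.

End IsomorphismClasses.

(* The right A-module M_phi: m * b = m.phi(b). *)
Definition twisted (A : pzRingType) (phi : {rmorphism A -> A})
  (M : lmodType A^c) : Type := M.

Section TwistedModule.
Variables (A : pzRingType) (phi : {rmorphism A -> A}) (M : lmodType A^c).
Local Notation twisted := (twisted phi).
HB.instance Definition _ := GRing.Zmodule.on (twisted M).

Definition twisted_scale (b : A^c) (m : twisted M) : twisted M :=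
  (phi b : A^c) *: (m : M).

Fact twisted_scaleA a b m :
  twisted_scale a (twisted_scale b m) = twisted_scale (a * b) m.
Proof. by rewrite /twisted_scale scalerA -[a * b]/((b : A) * a) rmorphM. Qed.
Fact twisted_scale1 : left_id 1 twisted_scale.
Proof. by move=> m; rewrite /twisted_scale rmorph1 scale1r. Qed.
Fact twisted_scaleDr : right_distributive twisted_scale +%R.
Proof. by move=> a u v; rewrite /twisted_scale scalerDr. Qed.
Fact twisted_scaleDl m : {morph twisted_scale^~ m : a b / a + b}.
Proof.
by move=> a b; rewrite /twisted_scale -[a + b]/((a : A) + b) rmorphD scalerDl.
Qed.
HB.instance Definition _ := GRing.Zmodule_isLmodule.Build A^c (twisted M)
  twisted_scaleA twisted_scale1 twisted_scaleDr twisted_scaleDl.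

End TwistedModule.

Section QuotientRingMorphism.
Variables (A : pzRingType) (S : A -> Prop) (phi : {rmorphism A -> A}).
Hypothesis phiS : forall u, S u -> ideal_gen S (phi u).

Lemma ideal_gen_morph a : ideal_gen S a -> ideal_gen S (phi a).
Proof.
move=> Ia; apply: (Ia (fun a => ideal_gen S (phi a))) => //.
- by rewrite rmorph0 => N.
- by move=> u v Iu Iv; rewrite rmorphD; apply: ideal_genD.
- by move=> b c u Iu; rewrite !rmorphM; apply: ideal_genM.
Qed.

Definition qring_map (b : qring S) : qring S := qring_pi S (phi (qring_repr b)).

Lemma qring_map_pi a : qring_map (qring_pi S a) = qring_pi S (phi a).
Proof.
apply/qring_piP; rewrite -rmorphB; apply: ideal_gen_morph.
by apply/qring_piP; rewrite qring_reprK.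
Qed.

Lemma qring_map_zmod : zmod_morphism qring_map.
Proof.
move=> a b; rewrite -[a]qring_reprK -[b]qring_reprK.
by rewrite -raddfB !qring_map_pi !raddfB.
Qed.

Lemma qring_map_monoid : monoid_morphism qring_map.
Proof.
split=> [|a b]; first by rewrite -[1](rmorph1 (qring_pi S)) qring_map_pi !rmorph1.
rewrite -[a]qring_reprK -[b]qring_reprK.
by rewrite -rmorphM !qring_map_pi !rmorphM.
Qed.

End QuotientRingMorphism.

Section EquivariantAutomorphisms.
Variables (F : fieldType) (gT : finGroupType) (eps : primChar F gT).
Local Notation R := (crossed eps).

(* G: automorphisms of the C-algebra R that are the identity on C Gamma and
   fix x y - y x; the inverse is part of the data. *)
Record equivAut := EquivAut {
  ea_fun :> {lrmorphism R -> R};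
  ea_inv : {lrmorphism R -> R};
  ea_funK : cancel ea_fun ea_inv;
  ea_invK : cancel ea_inv ea_fun;
  ea_grp : forall g, ea_fun (cr_grp eps g) = cr_grp eps g;
  ea_comm : ea_fun (cr_comm eps) = cr_comm eps }.

Definition equivAutV (s : equivAut) : equivAut.
Proof.
exists (ea_inv s) (ea_fun s); first exact: ea_invK; first exact: ea_funK.
- by move=> g; rewrite -{1}(ea_grp s g) ea_funK.
- by rewrite -{1}(ea_comm s) ea_funK.
Defined.

Variable tau : {ffun gT -> F}.
Local Notation B := (Btau eps tau).

Lemma ea_grpalg (s : equivAut) : s (cr_grpalg eps tau) = cr_grpalg eps tau.
Proof.
rewrite /cr_grpalg raddf_sum; apply: eq_bigr => g _.
by rewrite -[in RHS](ea_grp s g); exact: linearZ.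
Qed.

Lemma ea_relator (s : equivAut) : s (relator eps tau) = relator eps tau.
Proof. by rewrite raddfB /= ea_grpalg ea_comm. Qed.

Fact ea_ideal (s : equivAut) u :
  relator eps tau = u -> ideal_gen (eq (relator eps tau)) (s u).
Proof. by move=> <-; rewrite ea_relator => N _ _ _; apply. Qed.

Definition autB (s : equivAut) : B -> B :=
  @qring_map R (eq (relator eps tau)) s.
HB.instance Definition _ s := GRing.isZmodMorphism.Build B B (autB s)
  (qring_map_zmod (@ea_ideal s)).
HB.instance Definition _ s := GRing.isMonoidMorphism.Build B B (autB s)
  (qring_map_monoid (@ea_ideal s)).

(* sigma_* M = M_{sigma^-1} *)
Definition push (s : equivAut) (M : lmodType B^c) : lmodType B^c :=
  twisted (autB (equivAutV s)) M.

Definition push_class (s : equivAut) (c : lmodType B^c -> Prop) :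
    lmodType B^c -> Prop :=
  fun N => exists M, c M /\ lmod_iso (push s M) N.

(* [M] = [P (x) B] - [Q (x) B] in K_0(B), i.e. up to stable isomorphism, for a
   virtual representation P - Q of Gamma of dimension 1. *)
Definition K0_dim1 (M : lmodType B^c) : Prop :=
  exists (dP dQ k : nat) (P : gammaRep F gT dP) (Q : gammaRep F gT dQ),
    dP = dQ.+1 /\
    lmod_iso ((M * tens (Bpi eps tau) Q) * 'cV[B^c]_k)%type
             (tens (Bpi eps tau) P * 'cV[B^c]_k)%type.

(* The set of classes on which G acts; an isomorphism class of modules is
   represented by the predicate [iso_class M]. *)
Definition calR (c : lmodType B^c -> Prop) : Prop :=
  exists M, c = iso_class M /\ fg_projective M /\ K0_dim1 M.

Section ActionOnQuadruples.
Variables (s : equivAut) (q : quadruple eps tau).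
Local Notation d := (q_dim q).
Let sX : 'M[F]_d := act_mx q (ea_inv s (cr_x eps)).
Let sY : 'M[F]_d := act_mx q (ea_inv s (cr_y eps)).

Fact aq_moment :
  sX *m sY - sY *m sX + \sum_g tau g *: q_U q g = q_i q *m q_j q.
Proof.
rewrite -q_moment; congr (_ + _); rewrite /sX /sY.
have MM a b : act_mx q (ea_inv s a) *m act_mx q (ea_inv s b) =
    act_mx q (ea_inv s (b * a)) by rewrite -act_mxM; congr act_mx; rewrite rmorphM.
rewrite (MM (cr_x eps) (cr_y eps)) (MM (cr_y eps) (cr_x eps)) -act_mxB.
have comm_inv : ea_inv s (cr_comm eps) = cr_comm eps := ea_comm (equivAutV s).
have {}comm_inv : ea_inv s (cr_y eps * cr_x eps) - ea_inv s (cr_x eps * cr_y eps)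
    = cr_y eps * cr_x eps - cr_x eps * cr_y eps.
  by rewrite -opprB -(raddfB (ea_inv s)) [X in - X]comm_inv opprB.
rewrite comm_inv.
by rewrite act_mxB !act_mxM act_mx_x act_mx_y.
Qed.

Fact aq_XU g : sX *m q_U q g = eps g *: (q_U q g *m sX).
Proof.
rewrite -act_mx_grp -act_mxM -act_mxM -act_mxZ; congr act_mx.
rewrite -(ea_grp (equivAutV s) g).
rewrite -[LHS](rmorphM (ea_inv s)) -[X in _ *: X](rmorphM (ea_inv s)) cr_grp_x.
exact: linearZ.
Qed.

Fact aq_YU g : sY *m q_U q g = (eps g)^-1 *: (q_U q g *m sY).
Proof.
rewrite -act_mx_grp -act_mxM -act_mxM -act_mxZ; congr act_mx.
rewrite -(ea_grp (equivAutV s) g).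
rewrite -[LHS](rmorphM (ea_inv s)) -[X in _ *: X](rmorphM (ea_inv s)) cr_grp_y.
exact: linearZ.
Qed.

Lemma aq_cr_mx (r : R) : cr_mx (q_U q) sX sY r = act_mx q (ea_inv s r).
Proof.
elim/cr_ind: r => [|c r t IHr IHt|r t IHr IHt|g||].
- by rewrite (raddf0 (cr_mx (q_U q) sX sY)) raddf0 /act_mx raddf0.
- rewrite cr_mx_is_linear IHr IHt -act_mxZ -act_mxD; congr act_mx.
  by rewrite linearP.
- rewrite (cr_mxM aq_XU aq_YU) IHr IHt -act_mxM; congr act_mx.
  by rewrite rmorphM.
- by rewrite cr_mx_grp -[in RHS](ea_grp s g) ea_funK act_mx_grp.
- exact: cr_mx_x.
- exact: cr_mx_y.
Qed.

Fact aq_stable (V : {vspace 'cV[F]_d}) :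
  q_i q \in V ->
  (forall g, {in V, forall v, q_U q g *m v \in V}) ->
  {in V, forall v, sX *m v \in V} ->
  {in V, forall v, sY *m v \in V} ->
  V = fullv.
Proof.
move=> iV UV XV YV; apply: (q_stable iV UV) => v vV.
- rewrite -(act_mx_x q) -(ea_funK s (cr_x eps)) -aq_cr_mx.
  exact: cr_mx_stable.
- rewrite -(act_mx_y q) -(ea_funK s (cr_y eps)) -aq_cr_mx.
  exact: cr_mx_stable.
Qed.

(* sigma.(X, Y, i, j) = (sigma^-1(X), sigma^-1(Y), i, j) *)
Definition act_quad : quadruple eps tau :=
  Quadruple aq_moment aq_XU aq_YU (@q_iU _ _ _ _ q) (@q_jU _ _ _ _ q) aq_stable.

End ActionOnQuadruples.

(* Isomorphism of quadruples: for a fixed Gamma-module U this is the action of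
   its automorphism group, and for varying U it also identifies isomorphic
   Gamma-modules. *)
Definition quad_iso (p q : quadruple eps tau) : Prop :=
  q_n p = q_n q /\
  exists (h : 'M[F]_(q_dim q, q_dim p)) (h' : 'M[F]_(q_dim p, q_dim q)),
    [/\ h *m h' = 1%:M & h' *m h = 1%:M] /\
    (forall g, h *m q_U p g = q_U q g *m h) /\
    [/\ h *m q_X p = q_X q *m h, h *m q_Y p = q_Y q *m h,
        h *m q_i p = q_i q & q_j p = q_j q *m h].

Definition quad_isob (p q : quadruple eps tau) : bool := `[< quad_iso p q >].

Lemma quad_isob_equiv : equiv_class_of quad_isob.
Proof.
split.
- move=> p; apply/asboolP; split=> //; exists 1%:M, 1%:M.
  by split; [split; rewrite mulmx1 | split=> [g|]; [|split]; rewrite ?mul1mx ?mulmx1].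
- have sym p q : quad_iso p q -> quad_iso q p.
    move=> [en [h [h' [[hh' h'h] [hU [hX hY hi hj]]]]]].
    have inv (M N : 'M[F]_(_, _)) : h *m M = N *m h -> h' *m N = M *m h'.
      by move=> E; rewrite -[N]mulmx1 -hh' [N *m _]mulmxA -E !mulmxA h'h mul1mx.
    split=> //; exists h', h; split=> //; split=> [g|]; first exact: inv.
    split; [exact: inv | exact: inv | |].
      by rewrite -hi mulmxA h'h mul1mx.
    by rewrite hj -mulmxA hh' mulmx1.
  by move=> p q; apply/asboolP/asboolP; apply: sym.
- move=> q p r /asboolP [en [h [h' [[hh' h'h] [hU [hX hY hi hj]]]]]].
  move=> /asboolP [en2 [k [k' [[kk' k'k] [kU [kX kY ki kj]]]]]].
  apply/asboolP; split; first by rewrite en.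
  exists (k *m h), (h' *m k').
  split; first split.
  + by rewrite mulmxA -[k *m h *m h']mulmxA hh' mulmx1.
  + by rewrite mulmxA -[h' *m k' *m k]mulmxA k'k mulmx1.
  split=> [g|]; first by rewrite -mulmxA hU mulmxA kU mulmxA.
  split.
  + by rewrite -mulmxA hX mulmxA kX mulmxA.
  + by rewrite -mulmxA hY mulmxA kY mulmxA.
  + by rewrite -mulmxA hi.
  + by rewrite hj kj mulmxA.
Qed.

HB.instance Definition _ := gen_eqMixin (quadruple eps tau).
HB.instance Definition _ := gen_choiceMixin (quadruple eps tau).
Canonical quad_isob_equivRel := EquivRelPack quad_isob_equiv.
Canonical quad_isob_encModRel := defaultEncModRel quad_isob.

(* The disjoint union over n and over the isomorphism classes of U of the
   varieties attached to (U, W_n). *)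
Definition Mtau : Type := {eq_quot quad_isob}%qT.

Local Open Scope quotient_scope.
Definition Mtau_pi (q : quadruple eps tau) : Mtau := \pi_{eq_quot quad_isob} q.
Definition Mtau_repr (p : Mtau) : quadruple eps tau :=
  repr (p : {eq_quot quad_isob}).
Local Close Scope quotient_scope.

Definition act_Mtau (s : equivAut) (p : Mtau) : Mtau :=
  Mtau_pi (act_quad s (Mtau_repr p)).

Definition Omega (p : Mtau) : lmodType B^c -> Prop :=
  iso_class (H0 (Mtau_repr p)).

End EquivariantAutomorphisms.

Section Generic.
Variables (F : fieldType) (gT : finGroupType) (eps : primChar F gT).
Local Notation m := #|gT|.

(* The multiplicity of W_j in L (x) W_i, where L = eps + eps^-1; the Cartan
   matrix has a zero diagonal entry when m = 1, so that there are no real roots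
   in that case. *)
Definition mckay_adj (i j : 'I_m) : nat :=
  (j == i.+1 %[mod m])%N + (i == j.+1 %[mod m])%N.

Definition cartan (i j : 'I_m) : int :=
  2 * (i == j)%:Z - (mckay_adj i j)%:Z.

Inductive real_root : {ffun 'I_m -> int} -> Prop :=
| SimpleRoot i : cartan i i = 2 -> real_root [ffun k => (k == i)%:Z]
| ReflectedRoot i al : cartan i i = 2 -> real_root al ->
    real_root
      [ffun k => al k - (\sum_j al j * cartan j i) * (k == i)%:Z].

(* The nonzero multiples of the vector of the dimensions of the W_i. *)
Definition imaginary_root (al : {ffun 'I_m -> int}) : Prop :=
  exists2 k : int, k != 0 & al = [ffun=> k].

(* The scalar by which tau acts on W_i. *)
Definition tau_on (tau : {ffun gT -> F}) (i : 'I_m) : F :=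
  \sum_g tau g * eps g ^+ i.

Definition generic (tau : {ffun gT -> F}) : Prop :=
  forall al, real_root al \/ imaginary_root al ->
    \sum_i (al i)%:~R * tau_on tau i != 0.

End Generic.

(* Main.v *)
From HB Require Import structures.
Require Import Defs.
From mathcomp Require Import all_boot all_order all_fingroup all_algebra.
From mathcomp Require Import all_character generic_quotient.
From mathcomp Require Import boolp reals complex.

(* For an automorphism sigma in G, a module M is related to sigma_* M by the
   identity map, which is sigma-semilinear.  Since sigma fixes C Gamma and
   xy - yx - tau, applying sigma coordinatewise gives sigma-semilinear
   bijections of free modules and of the modules P (x) B with themselves, and
   e_n (x) a |-> e_n (x) sigma(a) gives one from H^0(L) for a quadruple to
   H^0(L) for its image under sigma.  An isomorphism conjugated by
   sigma-semilinear bijections is linear again, which yields both claims. *)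

Section Equivariance.
Set Implicit Arguments.
Unset Strict Implicit.
Import GRing.Theory.
Local Open Scope ring_scope.

(** * Semilinear maps between modules and their inverses *)

Section SemilinearBijections.
Definition semilinear (A : pzRingType) (phi : A -> A) (M N : lmodType A)
    (f : M -> N) :=
  forall a u v, f (a *: u + v) = phi a *: f u + f v.

(** Nothing is asked of the inverse [g] beyond cancellation: if [phi] is invertible,
    [semilinear_inv] makes [g] semilinear over the inverse of [phi]. *)
Definition semi_iso (A : pzRingType) (phi : A -> A) (M N : lmodType A) :=
  exists (f : M -> N) (g : N -> M),
    [/\ semilinear phi f, cancel f g & cancel g f].

Variables (A : pzRingType) (phi psi : {rmorphism A -> A}).
Implicit Types M N : lmodType A.

Lemma lmod_iso_refl M : lmod_iso M M.
Proof. by exists idfun; exists idfun. Qed.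

Lemma lmod_iso_sym M N : lmod_iso M N -> lmod_iso N M.
Proof.
move=> [f [g fK gK]].
have lin : linear g by move=> a u v; rewrite -[RHS]fK linearP !gK.
pose G : {linear N -> M} := HB.pack g (GRing.isLinear.Build A N M *:%R g lin).
by exists G; exists f.
Qed.

Lemma lmod_iso_trans M N N' : lmod_iso M N -> lmod_iso N N' -> lmod_iso M N'.
Proof.
move=> [f fB] [g gB]; exists (g \o f : {linear _ -> _}).
exact: bij_comp.
Qed.

Lemma iso_class_eq M N : lmod_iso M N -> iso_class M = iso_class N.
Proof.
move=> MN; apply/funext => N'; apply/propext; split.
  by apply: lmod_iso_trans; apply: lmod_iso_sym.
exact: lmod_iso_trans.
Qed.

Lemma semilinearD M N (f : M -> N) :
  semilinear phi f -> {morph f : u v / u + v}.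
Proof. by move=> fP u v; rewrite -{1}[u]scale1r fP rmorph1 scale1r. Qed.

Lemma semilinear0 M N (f : M -> N) : semilinear phi f -> f 0 = 0.
Proof.
by move=> fP; apply: (@addrI _ (f 0)); rewrite -(semilinearD fP) !addr0.
Qed.

Lemma semilinearB M N (f : M -> N) :
  semilinear phi f -> {morph f : u v / u - v}.
Proof.
move=> fP u v; apply: (@addIr _ (f v)).
by rewrite -(semilinearD fP) !subrK.
Qed.

Hypothesis psiK : cancel psi phi.

Lemma semilinear_inv M N (f : M -> N) (g : N -> M) :
  semilinear phi f -> cancel f g -> cancel g f -> semilinear psi g.
Proof. by move=> fP fK gK a u v; rewrite -[RHS]fK fP psiK !gK. Qed.

(** The conjugate [k \o h \o f'] twists scalars by [psi] and then by [phi], and these two twists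
    cancel. *)
Lemma lmod_iso_semi M M' N N' :
  semi_iso phi M M' -> semi_iso phi N N' -> lmod_iso M N -> lmod_iso M' N'.
Proof.
move=> [f [f' [fP fK f'K]]] [k [k' [kP kK k'K]]] [h [h' hK h'K]].
have f'P := semilinear_inv fP fK f'K.
have lin : linear (k \o h \o f').
  by move=> a u v; rewrite /= f'P linearP kP psiK.
pose F : {linear M' -> N'} := HB.pack (k \o h \o f')
  (GRing.isLinear.Build A M' N' *:%R _ lin).
exists F; exists (f \o h' \o k') => u; rewrite /F /=.
  by rewrite kK hK f'K.
by rewrite fK h'K k'K.
Qed.

Lemma semi_iso_prod M M' N N' :
  semi_iso phi M M' -> semi_iso phi N N' ->
  semi_iso phi (M * N)%type (M' * N')%type.
Proof.
move=> [f [f' [fP fK f'K]]] [k [k' [kP kK k'K]]].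
exists (fun u => (f u.1, k u.2)), (fun u => (f' u.1, k' u.2)).
split=> [a u v | [u v] | [u v]] /=; last 2 first.
- by rewrite fK kK.
- by rewrite f'K k'K.
by rewrite fP kP.
Qed.

Hypothesis phiK : cancel phi psi.

Lemma map_mx_semilinear (chi : {rmorphism A -> A}) k :
  semilinear chi (map_mx chi : 'cV[A]_k -> 'cV[A]_k).
Proof. by move=> a u v; apply/matrixP => i j; rewrite !mxE rmorphD rmorphM. Qed.

Lemma semi_iso_cV k : semi_iso phi 'cV[A]_k 'cV[A]_k.
Proof.
exists (map_mx phi), (map_mx psi); split; first exact: map_mx_semilinear.
  by move=> u; apply/matrixP => i j; rewrite !mxE phiK.
by move=> u; apply/matrixP => i j; rewrite !mxE psiK.
Qed.

End SemilinearBijections.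

(** * Descent of semilinear maps to quotient modules *)

Section QuotientMap.
Variables (A : pzRingType) (phi : {rmorphism A -> A}) (M M' : lmodType A).
Variables (S : M -> Prop) (S' : M' -> Prop) (f : M -> M').
Hypothesis fP : semilinear phi f.
Hypothesis fS : forall u, S u -> S' (f u).

Definition qmod_map (m : qmod S) : qmod S' := qmod_pi S' (f (qmod_repr m)).

(** Independence of the representative: the preimage under a semilinear map of the submodule
    generated by [S'] is a submodule, and it contains [S]. *)
Lemma qmod_map_pi u : qmod_map (qmod_pi S u) = qmod_pi S' (f u).
Proof.
apply/qmod_piP; rewrite -(semilinearB fP).
have /qmod_piP gen : qmod_pi S (qmod_repr (qmod_pi S u)) = qmod_pi S u.
  by rewrite qmod_reprK.
apply: (gen (fun v => submod_gen S' (f v))).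
- by rewrite (semilinear0 fP) => N.
- move=> a v w Sv Sw N N0 NL NS; rewrite fP; apply: (NL); first exact: Sv.
  exact: Sw.
- by move=> v /fS S'v N _ _; apply.
Qed.

Lemma qmod_map_semilinear : semilinear phi qmod_map.
Proof.
move=> a m n; rewrite -[m]qmod_reprK -[n]qmod_reprK -linearP !qmod_map_pi.
by rewrite fP linearP.
Qed.

End QuotientMap.

Lemma qmod_mapK (A : pzRingType) (phi psi : {rmorphism A -> A})
    (M M' : lmodType A) (S : M -> Prop) (S' : M' -> Prop)
    (f : M -> M') (g : M' -> M) :
  semilinear phi f -> (forall u, S u -> S' (f u)) ->
  semilinear psi g -> (forall u, S' u -> S (g u)) ->
  cancel f g -> cancel (qmod_map (S := S) S' f) (qmod_map S g).
Proof.
move=> fP fS gP gS fK m; rewrite -[m]qmod_reprK.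
by rewrite (qmod_map_pi fP fS) (qmod_map_pi gP gS) fK.
Qed.

(** Right modules are encoded over [A^c], so the twist must be a morphism of the converse ring; the
    underlying map is unchanged. *)
Definition rmorphC (A : pzRingType) (phi : {rmorphism A -> A}) :
    {rmorphism A^c -> A^c} :=
  HB.pack (phi : A^c -> A^c)
    (GRing.isZmodMorphism.Build A^c A^c phi (raddfB phi))
    (GRing.isMonoidMorphism.Build A^c A^c phi
       (conj (rmorph1 phi) (fun a b => rmorphM phi b a))).

(** * Coordinatewise twist of the relations defining a tensor product *)

Section Tensor.
Variables (F : fieldType) (gT : finGroupType) (eps : primChar F gT).
Variables (A : pzRingType) (f : {rmorphism crossed eps -> A}).
Variables (d : nat) (P Q : gammaRep F gT d) (phi : {rmorphism A -> A}).
Hypothesis phi_scalar : forall c : F, phi (f c%:A) = f c%:A.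
Hypothesis phi_grp : forall g, phi (f (cr_grp eps g)) = f (cr_grp eps g).
Hypothesis PQ : forall g, P g = Q g.

Lemma map_pure_tens (p : 'cV[F]_d) a :
  map_mx (rmorphC phi) (pure_tens f p a) = pure_tens f p (phi a).
Proof.
by apply/colP => k; rewrite !mxE -[LHS]/(phi (_ * _)) rmorphM phi_scalar.
Qed.

(** As [phi] fixes the images of scalars and of Gamma, a relation keeps its [p] and [g], and only
    [a] is twisted. Two representations with equal matrices are allowed because the indices [q_n] of
    two quadruples are equal only propositionally. *)
Lemma map_tens_rel v :
  tens_rel f P v -> tens_rel f Q (map_mx (rmorphC phi) v).
Proof.
move=> [p [g [a ->]]]; exists p, g, (phi a).
by rewrite map_mxB !map_pure_tens rmorphM phi_grp PQ.
Qed.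

End Tensor.

(** * The action of G on modules over B *)

Variables (F : fieldType) (gT : finGroupType) (eps : primChar F gT).
Variable tau : {ffun gT -> F}.
Local Notation R := (crossed eps).
Local Notation B := (Btau eps tau).
Implicit Types (s : equivAut eps) (M N : lmodType B^c).

Lemma Bpi_surj (b : B) : exists a, b = Bpi eps tau a.
Proof. by exists (qring_repr b); rewrite -[LHS]qring_reprK. Qed.

Lemma autB_pi s a : autB s (Bpi eps tau a) = Bpi eps tau (s a).
Proof. exact: (qring_map_pi (@ea_ideal _ _ _ tau s)). Qed.

Lemma autBK s : cancel (autB (tau := tau) s) (autB (equivAutV s)).
Proof.
move=> b; have [a ->] := Bpi_surj b.
by rewrite (autB_pi s a) (autB_pi _ (s a)) [equivAutV s _]ea_funK.
Qed.

Lemma autBVK s : cancel (autB (tau := tau) (equivAutV s)) (autB s).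
Proof.
move=> b; have [a ->] := Bpi_surj b.
by rewrite (autB_pi _ a) (autB_pi s _) [s _](ea_invK s).
Qed.

Lemma ea_scalar s (c : F) : s c%:A = c%:A.
Proof. by rewrite linearZ rmorph1. Qed.

Local Notation autBc s := (rmorphC (autB (tau := tau) s)).

(** On [push s M] scalars act through the inverse of [s], so [s a] acts there as [a] does on [M]. *)
Lemma semi_iso_push s M : semi_iso (autBc s) M (push s M).
Proof.
exists (fun m => m), (fun m => m); split=> // a u v.
by rewrite -[autBc s a *: _]/((autB (equivAutV s) (autB s a) : B^c) *: u) autBK.
Qed.

Lemma semi_iso_tens s d (P : gammaRep F gT d) :
  semi_iso (autBc s) (tens (Bpi eps tau) P) (tens (Bpi eps tau) P).
Proof.
have rel s' : forall v, tens_rel (Bpi eps tau) P v ->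
    tens_rel (Bpi eps tau) P (map_mx (autBc s') v).
  apply: map_tens_rel => [c | g | //]; rewrite [LHS]autB_pi.
    by rewrite ea_scalar.
  by rewrite ea_grp.
have semi s' := @map_mx_semilinear _ (autBc s') d.
exists (qmod_map _ (map_mx (autBc s))).
exists (qmod_map _ (map_mx (autBc (equivAutV s)))); split.
- exact: qmod_map_semilinear (semi s) (rel s).
- apply: qmod_mapK (semi s) (rel s) (semi _) (rel _) _ => u.
  by apply/matrixP => i j; rewrite !mxE; exact: autBK.
- apply: qmod_mapK (semi _) (rel _) (semi s) (rel s) _ => u.
  by apply/matrixP => i j; rewrite !mxE; exact: autBVK.
Qed.

Lemma semi_iso_cV_autB s k : semi_iso (autBc s) 'cV[B^c]_k 'cV[B^c]_k.
Proof.
exact: (@semi_iso_cV _ (autBc s) (autBc (equivAutV s)) (autBVK s) (autBK s)).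
Qed.

Lemma lmod_iso_autB s M M' N N' : semi_iso (autBc s) M M' ->
  semi_iso (autBc s) N N' -> lmod_iso M N -> lmod_iso M' N'.
Proof.
exact: (@lmod_iso_semi _ (autBc s) (autBc (equivAutV s)) (autBVK s)).
Qed.

Lemma fg_projective_push s M : fg_projective M -> fg_projective (push s M).
Proof.
move=> [k [N MN]]; exists k, (push s N).
apply: (lmod_iso_autB (s := s)) MN; last exact: semi_iso_cV_autB.
by apply: semi_iso_prod; exact: semi_iso_push.
Qed.

(** The same [P], [Q] and [k] serve again, since induced and free modules are semilinearly
    isomorphic to themselves. *)
Lemma K0_dim1_push s M : K0_dim1 M -> K0_dim1 (push s M).
Proof.
move=> [dP [dQ [k [P [Q [dPQ iso]]]]]]; exists dP, dQ, k, P, Q; split=> //.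
apply: (lmod_iso_autB (s := s)) iso; apply: semi_iso_prod.
- apply: semi_iso_prod; [exact: semi_iso_push | exact: semi_iso_tens].
- exact: semi_iso_cV_autB.
- exact: semi_iso_tens.
- exact: semi_iso_cV_autB.
Qed.

Lemma lmod_iso_push s M N : lmod_iso M N -> lmod_iso (push s M) (push s N).
Proof. by apply: lmod_iso_autB; exact: semi_iso_push. Qed.

Lemma push_iso_class s M : push_class s (iso_class M) = iso_class (push s M).
Proof.
apply/funext => N; apply/propext; split=> [[M' [MM' M'N]] | MN].
  by apply: lmod_iso_trans M'N; apply: lmod_iso_push.
by exists M; split=> //; apply: lmod_iso_refl.
Qed.

Lemma calR_push s (c : lmodType B^c -> Prop) : calR c -> calR (push_class s c).
Proof.
move=> [M [-> [Mproj M1]]]; exists (push s M).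
split; first exact: push_iso_class.
by split; [apply: fg_projective_push | apply: K0_dim1_push].
Qed.

(** * Transport of the complexes L *)

Section Complex.

(* The complexes L of p and q correspond under e_n (x) a |-> e_n (x) s(a). *)
Definition quad_related s (p q : quadruple eps tau) : Prop :=
  [/\ q_n p = q_n q, forall a, lam q (s a) = lam p a &
      forall a, dL (en_tens0 q (s a)) = 0 <-> dL (en_tens0 p a) = 0].

Variables (s : equivAut eps) (p q : quadruple eps tau).
Hypothesis pq : quad_related s p q.
Local Notation sc := (rmorphC (ea_fun s : {rmorphism R -> R})).

Definition WR_map : WR p -> WR q :=
  qmod_map (tens_rel idfun (Wn eps (q_n q))) (map_mx sc).

Lemma WR_tens_rel v : tens_rel idfun (Wn eps (q_n p)) v ->
  tens_rel idfun (Wn eps (q_n q)) (map_mx sc v).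
Proof.
apply: map_tens_rel => [c | g | g]; first exact: ea_scalar.
  exact: ea_grp.
by have [-> _ _] := pq.
Qed.

Lemma WR_map_semilinear : semilinear sc WR_map.
Proof.
by apply: qmod_map_semilinear; [apply: map_mx_semilinear | apply: WR_tens_rel].
Qed.

Lemma WR_map_en a : WR_map (en_tens p a) = en_tens q (s a).
Proof.
rewrite /WR_map /en_tens.
rewrite (qmod_map_pi (@map_mx_semilinear _ sc 1) WR_tens_rel).
by rewrite map_pure_tens // => c; exact: ea_scalar.
Qed.

Definition L0_map : L0 p -> L0 q := qmod_map (@L0_rel _ _ _ _ q) WR_map.

(** The relation attached to [a] goes to the one attached to [s a]: [s] fixes [relator] and the
    scalars, and [lam] is compatible with [s]. *)
Lemma WR_map_rel m : L0_rel m -> L0_rel (WR_map m).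
Proof.
move=> [a ->]; exists (s a); have [_ lamE _] := pq.
rewrite WR_map_en rmorphD rmorphM lamE.
by rewrite [X in _ * X]ea_relator [X in _ + X]ea_scalar.
Qed.

Lemma L0_map_semilinear : semilinear sc L0_map.
Proof.
by apply: qmod_map_semilinear; [apply: WR_map_semilinear | apply: WR_map_rel].
Qed.

Lemma L0_map_en a : L0_map (en_tens0 p a) = en_tens0 q (s a).
Proof.
rewrite /L0_map /en_tens0 (qmod_map_pi WR_map_semilinear WR_map_rel).
by rewrite WR_map_en.
Qed.

(** Every element of [L0 p] has the form [en_tens0 p a], so the kernel condition in [quad_related]
    decides all cases. *)
Lemma L0_map_kerd m : dL (L0_map m) = 0 <-> dL m = 0.
Proof.
have [a ->] := en_tens0_surj m; rewrite L0_map_en.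
by have [_ _] := pq; exact.
Qed.

Definition H0_map (m : H0 p) : H0 q :=
  MkH0 (introT eqP (proj2 (L0_map_kerd _) (H0_val_dL m))).

Lemma H0_map_semilinear : semilinear (autBc s) H0_map.
Proof.
move=> b u v; apply: val_inj; have [a ->] := Bpi_surj b.
rewrite [autBc s _]autB_pi /= [X in L0_map (X + _)]H0_scale_pi.
rewrite L0_map_semilinear; congr (_ + _).
exact/esym/(H0_scale_pi (s a) (H0_map u)).
Qed.

End Complex.

Lemma quad_related_sym s p q :
  quad_related s p q -> quad_related (equivAutV s) q p.
Proof.
move=> [en lamE kerE]; split=> // a.
  by rewrite -lamE [s _](ea_invK s).
by rewrite -kerE [s _](ea_invK s).
Qed.

Lemma L0_mapK s p q (pq : quad_related s p q)
    (qp : quad_related (equivAutV s) q p) :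
  cancel (@L0_map s p q) (@L0_map (equivAutV s) q p).
Proof.
move=> m; have [a ->] := en_tens0_surj m.
by rewrite (L0_map_en pq) (L0_map_en qp) [equivAutV s _]ea_funK.
Qed.

Lemma L0_mapVK s p q (pq : quad_related s p q)
    (qp : quad_related (equivAutV s) q p) :
  cancel (@L0_map (equivAutV s) q p) (@L0_map s p q).
Proof.
move=> m; have [a ->] := en_tens0_surj m.
by rewrite (L0_map_en qp) (L0_map_en pq) [s _](ea_invK s).
Qed.

Lemma semi_iso_H0 s p q :
  quad_related s p q -> semi_iso (autBc s) (H0 p) (H0 q).
Proof.
move=> pq; have qp := quad_related_sym pq.
exists (H0_map pq), (H0_map qp); split; first exact: H0_map_semilinear.
- by move=> m; apply: val_inj; apply: L0_mapK.
- by move=> m; apply: val_inj; apply: L0_mapVK.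
Qed.

(** Stated up to isomorphism because [Omega] uses a chosen representative of the orbit, which need
    not be [act_quad s p] itself. *)
Lemma act_quad_related s p q : quad_iso (act_quad s p) q -> quad_related s p q.
Proof.
move=> [en [h [h' [[hh' h'h] [hU [hX hY hi hj]]]]]].
have {}hi : h *m q_i p = q_i q := hi.
have {}hj : q_j p = q_j q *m h := hj.
have hact r : h *m act_mx p r = act_mx q (s r) *m h.
  (* The module of [act_quad s p] is that of [p] twisted by the inverse of [s]. It remains to see
     that [h] is R-linear from it to the module of [q], which is checked on generators. *)
  have -> : act_mx p r = act_mx (act_quad s p) (s r).
    by rewrite -[in LHS](ea_funK s r); exact/esym/aq_cr_mx.
  elim/cr_ind: (s r) => [|c a b IHa IHb|a b IHa IHb|g||].
  - by rewrite -[0]subr0 !act_mxB !subrr mulmx0 mul0mx.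
  - by rewrite !act_mxD !act_mxZ mulmxDr mulmxDl -scalemxAr -scalemxAl IHa IHb.
  - by rewrite !act_mxM mulmxA IHb -!mulmxA IHa.
  - by rewrite !act_mx_grp.
  - by rewrite !act_mx_x.
  - by rewrite !act_mx_y.
(* So [h] matches the values of [dL]: the claim on [lam] then follows from [hj], and the one on
   kernels from the invertibility of [h]. *)
have hacti a : act_mx q (s a) *m q_i q = h *m (act_mx p a *m q_i p).
  by rewrite -hi mulmxA -hact mulmxA.
split=> // a; first by rewrite /lam hacti hj !mulmxA.
rewrite !dL_en hacti; split=> [E | E]; last by rewrite [X in _ *m X]E mulmx0.
by rewrite -[LHS]mul1mx -h'h -mulmxA [X in _ *m X]E mulmx0.
Qed.

(** * Equivariance on orbits *)

Lemma Mtau_reprK (x : quadruple eps tau) : quad_iso x (Mtau_repr (Mtau_pi x)).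
Proof.
apply/asboolP/(@eqmodP _ (quad_isob_equivRel eps tau)).
by rewrite [RHS]reprK.
Qed.

Lemma Omega_act s (p : Mtau eps tau) :
  Omega (act_Mtau s p) = push_class s (Omega p).
Proof.
rewrite /Omega push_iso_class; apply: iso_class_eq.
(* Both sides are semilinear images of the same module, so the isomorphism is its identity map,
   conjugated. *)
apply: lmod_iso_autB (lmod_iso_refl (H0 (Mtau_repr p))).
  by apply: semi_iso_H0; apply: act_quad_related; apply: Mtau_reprK.
exact: semi_iso_push.
Qed.

End Equivariance.

Theorem theorem6 (R : realType) (gT : finGroupType)
    (eps : primChar R[i] gT) (tau : {ffun gT -> R[i]})
    (tau_generic : generic eps tau) :
  (forall (s : equivAut eps) (c : lmodType (Btau eps tau)^c -> Prop),
     calR c -> calR (push_class s c)) /\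
  (forall (s : equivAut eps) (p : Mtau eps tau),
     Omega (act_Mtau s p) = push_class s (Omega p)).
Proof. by split=> s; [exact: calR_push | exact: Omega_act]. Qed.
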